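(* Let $(A,\cdot,\{~,~\})$ be an $F$-manifold algebra and $R:A\to A$ be a Reynolds operator on it. Then $(A,\ast,\curlyvee,\diamond,\bullet)$ is an NS-$F$-manifold algebra, where $$x\ast y=R(x)\cdot y,\quad x\curlyvee y=-R(x)\cdot R(y),\quad x\diamond y=\{R(x),y\},\quad x\bullet y=-\{R(x),R(y)\},\qquad x,y\in A.$$
   Context: All vector spaces and (multi)linear maps are over a field $\mathbf{k}$ of characteristic $0$. Associative algebras are not required to be unital. An $F$-manifold algebra is a triple $(A,\cdot,\{~,~\})$ with $(A,\cdot)$ a commutative associative algebra, $(A,\{~,~\})$ a Lie algebra, and $P_{x\cdot y}(z,w)=x\cdot P_y(z,w)+y\cdot P_x(z,w)$ for all $x,y,z,w\in A$, where $P_x(y,z)=\{x,y\cdot z\}-\{x,y\}\cdot z-y\cdot\{x,z\}$. A Reynolds operator on an $F$-manifold algebra $(A,\cdot,\{~,~\})$ is a linear map $R:A\to A$ such that for all $x,y\in A$: $$R(x)\cdot R(y)=R\big(R(x)\cdot y+x\cdot R(y)-R(x)\cdot R(y)\big),\qquad \{R(x),R(y)\}=R\big(\{R(x),y\}+\{x,R(y)\}-\{R(x),R(y)\}\big).$$ An NS-commutative algebra is a triple $(A,\ast,\curlyvee)$ of a vector space $A$ with bilinear operations $\ast,\curlyvee$, where $\curlyvee$ is commutative, such that for all $x,y,z\in A$, with $x\odot y=x\ast y+y\ast x+x\curlyvee y$: $$x\ast(y\ast z)=(x\odot y)\ast z,\qquad x\ast(y\curlyvee z)+x\curlyvee(y\odot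 z)=y\ast(x\curlyvee z)+y\curlyvee(x\odot z).$$ An NS-Lie algebra is a triple $(A,\diamond,\bullet)$ of a vector space $A$ with bilinear operations $\diamond,\bullet$, where $\bullet$ is skew-symmetric, such that for all $x,y,z\in A$, with $\{\!\!\{x,y\}\!\!\}=x\diamond y-y\diamond x+x\bullet y$: $$x\diamond(y\diamond z)-(x\diamond y)\diamond z-y\diamond(x\diamond z)+(y\diamond x)\diamond z=(x\bullet y)\diamond z,$$ $$x\bullet\{\!\!\{y,z\}\!\!\}+y\bullet\{\!\!\{z,x\}\!\!\}+z\bullet\{\!\!\{x,y\}\!\!\}+x\diamond(y\bullet z)+y\diamond(z\bullet x)+z\diamond(x\bullet y)=0.$$ An NS-$F$-manifold algebra is a quintuple $(A,\ast,\curlyvee,\diamond,\bullet)$ such that $(A,\ast,\curlyvee)$ is an NS-commutative algebra, $(A,\diamond,\bullet)$ is an NS-Lie algebra, and for all $x,y,z,w\in A$: $$F_1(x\odot y,z,w)=x\ast F_1(y,z,w)+y\ast F_1(x,z,w),$$ $$\big(F_1(x,y,z)+F_1(x,z,y)+F_2(y,z,x)+F_3(x,y,z)\big)\ast w=F_2(y,z,x\ast w)-x\ast F_2(y,z,w),$$ $$F_3(x\odot y,z,w)+F_2(z,w,y\curlyvee x)=x\ast F_3(y,z,w)+y\ast F_3(x,z,w)+x\curlyvee\big(F_1(y,z,w)+F_1(y,w,z)+F_2(z,w,y)+F_3(y,z,w)\big)+y\curlyvee\big(F_1(x,z,w)+F_1(x,w,z)+F_2(z,w,x)+F_3(x,z,w)\big),$$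 where $F_1,F_2,F_3:A^{\otimes3}\to A$ are $$F_1(x,y,z)=x\diamond(y\ast z)-y\ast(x\diamond z)-\{\!\!\{x,y\}\!\!\}\ast z,$$ $$F_2(x,y,z)=x\ast(y\diamond z)+y\ast(x\diamond z)-(x\odot y)\diamond z,$$ $$F_3(x,y,z)=x\bullet(y\odot z)+x\diamond(y\curlyvee z)-z\ast(x\bullet y)-y\ast(x\bullet z)-y\curlyvee\{\!\!\{x,z\}\!\!\}-\{\!\!\{x,y\}\!\!\}\curlyvee z.$$ *)

(* Defs.v *)
From mathcomp Require Import all_boot all_order all_algebra.

Set Implicit Arguments.
Unset Strict Implicit.
Unset Printing Implicit Defensive.

Import GRing.Theory.
Local Open Scope ring_scope.

(* Products and brackets are plain binary functions on a k-vector space, not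
   ring structures: the associative product need not have a unit. *)

Definition is_bilinear (k : fieldType) (A : lmodType k) (op : A -> A -> A) : Prop :=
  bilinear_for *:%R *:%R op.

Definition skew_symmetric (A : zmodType) (op : A -> A -> A) : Prop :=
  forall x y, op x y = - op y x.

Record is_comm_assoc_algebra (k : fieldType) (A : lmodType k)
    (mul : A -> A -> A) : Prop := {
  caa_bilinear : is_bilinear mul;
  caa_comm : commutative mul;
  caa_assoc : associative mul
}.

(* Skew-symmetry is equivalent to br x x = 0 when the ground field
   has characteristic 0. *)
Record is_Lie_algebra (k : fieldType) (A : lmodType k)
    (br : A -> A -> A) : Prop := {
  Lie_bilinear : is_bilinear br;
  Lie_skew : skew_symmetric br;
  Lie_jacobi : forall x y z,
    br x (br y z) + br y (br z x) + br z (br x y) = 0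
}.

Definition leibnizator (A : zmodType) (mul br : A -> A -> A) (x y z : A) : A :=
  br x (mul y z) - mul (br x y) z - mul y (br x z).

Record is_F_manifold_algebra (k : fieldType) (A : lmodType k)
    (mul br : A -> A -> A) : Prop := {
  Fman_mul : is_comm_assoc_algebra mul;
  Fman_br : is_Lie_algebra br;
  Fman_HM : forall x y z w,
    leibnizator mul br (mul x y) z w =
    mul x (leibnizator mul br y z w) + mul y (leibnizator mul br x z w)
}.

Record is_Reynolds_operator (k : fieldType) (A : lmodType k)
    (mul br : A -> A -> A) (R : A -> A) : Prop := {
  Reynolds_linear : linear R;
  Reynolds_mul : forall x y,
    mul (R x) (R y) = R (mul (R x) y + mul x (R y) - mul (R x) (R y));
  Reynolds_br : forall x y,
    br (R x) (R y) = R (br (R x) y + br x (R y) - br (R x) (R y))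
}.

Definition ns_odot (A : zmodType) (ast vee : A -> A -> A) (x y : A) : A :=
  ast x y + ast y x + vee x y.

Record is_NS_commutative_algebra (k : fieldType) (A : lmodType k)
    (ast vee : A -> A -> A) : Prop := {
  NScomm_ast_bilinear : is_bilinear ast;
  NScomm_vee_bilinear : is_bilinear vee;
  NScomm_vee_comm : commutative vee;
  NScomm_ast : forall x y z,
    ast x (ast y z) = ast (ns_odot ast vee x y) z;
  NScomm_vee : forall x y z,
    ast x (vee y z) + vee x (ns_odot ast vee y z) =
    ast y (vee x z) + vee y (ns_odot ast vee x z)
}.

Definition ns_bracket (A : zmodType) (dia bul : A -> A -> A) (x y : A) : A :=
  dia x y - dia y x + bul x y.

Record is_NS_Lie_algebra (k : fieldType) (A : lmodType k)
    (dia bul : A -> A -> A) : Prop := {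
  NSLie_dia_bilinear : is_bilinear dia;
  NSLie_bul_bilinear : is_bilinear bul;
  NSLie_bul_skew : skew_symmetric bul;
  NSLie_dia : forall x y z,
    dia x (dia y z) - dia (dia x y) z - dia y (dia x z) + dia (dia y x) z =
    dia (bul x y) z;
  NSLie_bul : forall x y z,
    bul x (ns_bracket dia bul y z) + bul y (ns_bracket dia bul z x)
    + bul z (ns_bracket dia bul x y)
    + dia x (bul y z) + dia y (bul z x) + dia z (bul x y) = 0
}.

Definition ns_F1 (A : zmodType) (ast dia bul : A -> A -> A) (x y z : A) : A :=
  dia x (ast y z) - ast y (dia x z) - ast (ns_bracket dia bul x y) z.

Definition ns_F2 (A : zmodType) (ast vee dia : A -> A -> A) (x y z : A) : A :=
  ast x (dia y z) + ast y (dia x z) - dia (ns_odot ast vee x y) z.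

Definition ns_F3 (A : zmodType) (ast vee dia bul : A -> A -> A) (x y z : A) : A :=
  bul x (ns_odot ast vee y z) + dia x (vee y z)
  - ast z (bul x y) - ast y (bul x z)
  - vee y (ns_bracket dia bul x z) - vee (ns_bracket dia bul x y) z.

Record is_NS_F_manifold_algebra (k : fieldType) (A : lmodType k)
    (ast vee dia bul : A -> A -> A) : Prop := {
  NSF_comm : is_NS_commutative_algebra ast vee;
  NSF_Lie : is_NS_Lie_algebra dia bul;
  NSF_F1 : forall x y z w,
    let F1 := ns_F1 ast dia bul in
    F1 (ns_odot ast vee x y) z w = ast x (F1 y z w) + ast y (F1 x z w);
  NSF_F2 : forall x y z w,
    let F1 := ns_F1 ast dia bul in
    let F2 := ns_F2 ast vee dia in
    let F3 := ns_F3 ast vee dia bul in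
    ast (F1 x y z + F1 x z y + F2 y z x + F3 x y z) w =
    F2 y z (ast x w) - ast x (F2 y z w);
  NSF_F3 : forall x y z w,
    let F1 := ns_F1 ast dia bul in
    let F2 := ns_F2 ast vee dia in
    let F3 := ns_F3 ast vee dia bul in
    F3 (ns_odot ast vee x y) z w + F2 z w (vee y x) =
    ast x (F3 y z w) + ast y (F3 x z w)
    + vee x (F1 y z w + F1 y w z + F2 z w y + F3 y z w)
    + vee y (F1 x z w + F1 x w z + F2 z w x + F3 x z w)
}.

(* Main.v *)
Require Import Defs.
From mathcomp Require Import all_boot all_order all_algebra.

Set Implicit Arguments.
Unset Strict Implicit.
Unset Printing Implicit Defensive.

Import GRing.Theory.
Local Open Scope ring_scope.

(** Write [P] for the leibnizator of the F-manifold algebra.  By commutativity of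
    [mul] and skew-symmetry of [br], the Reynolds identities say that [R] carries
    the total products [ns_odot] and [ns_bracket] of the induced operations to
    [mul] and [br] on the image of [R] ([Reynolds_ns_odot],
    [Reynolds_ns_bracket]).  Hence the NS-commutative and NS-Lie axioms come down
    to associativity and the Jacobi identity, and the three defect maps are
      [F1 x y z = P (R x) (R y) z], [F2 x y z = P z (R x) (R y)] and
      [F3 x y z = - 2 P (R x) (R y) (R z)].

    The sum [F1 x y z + F1 x z y + F2 y z x + F3 x y z] is therefore
      [P (R x) (R y) z + P (R x) y (R z) + P x (R y) (R z)
       - 2 P (R x) (R y) (R z)],
    and the crux is that [R] sends it to [P (R x) (R y) (R z)].  This is a
    ternary Reynolds identity ([Reynolds3]): it holds for any operation nested
    twice out of Reynolds operations ([Reynolds3_nest]) and is stable under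
    differences and permutations of the arguments, so it holds for [P]
    ([Reynolds3_leibnizator]).  The three axioms on [F1], [F2] and [F3] are then
    instances of the Hertling-Manin relation: with one of the arguments of the
    product outside the image of [R] for the second, and with overall coefficient
    [-3] on both sides for the third. *)

(** * Additivity of bilinear operations *)

Lemma is_bilinearBl (k : fieldType) (A : lmodType k) (op : A -> A -> A) :
  is_bilinear op -> forall x y z, op (x - y) z = op x z - op y z.
Proof. by case=> opl _ x y z; apply: (zmod_morphism_linear (opl z)). Qed.

Lemma is_bilinearBr (k : fieldType) (A : lmodType k) (op : A -> A -> A) :
  is_bilinear op -> forall x y z, op x (y - z) = op x y - op x z.
Proof. by case=> _ opr x y z; apply: (zmod_morphism_linear (opr x)). Qed.

Lemma is_bilinearDr (k : fieldType) (A : lmodType k) (op : A -> A -> A) :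
  is_bilinear op -> forall x y z, op x (y + z) = op x y + op x z.
Proof. by case=> _ opr x y z; have /= := opr x 1 y z; rewrite !scale1r. Qed.

Lemma is_bilinear0r (k : fieldType) (A : lmodType k) (op : A -> A -> A) :
  is_bilinear op -> forall x, op x 0 = 0.
Proof. by move=> opB x; rewrite -[X in op x X](subrr 0) (is_bilinearBr opB) subrr. Qed.

Lemma is_bilinearNr (k : fieldType) (A : lmodType k) (op : A -> A -> A) :
  is_bilinear op -> forall x y, op x (- y) = - op x y.
Proof.
move=> opB x y.
by rewrite -[- y]sub0r (is_bilinearBr opB) (is_bilinear0r opB) sub0r.
Qed.

Lemma is_bilinearNl (k : fieldType) (A : lmodType k) (op : A -> A -> A) :
  is_bilinear op -> forall x y, op (- x) y = - op x y.
Proof.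
move=> opB x y; rewrite -[- x]sub0r (is_bilinearBl opB).
by rewrite -{1}(subrr 0) (is_bilinearBl opB) subrr sub0r.
Qed.

Lemma linear_sub (k : fieldType) (A : lmodType k) (R : A -> A) :
  linear R -> forall x y, R (x - y) = R x - R y.
Proof. by move=> Rlin; exact: (zmod_morphism_linear Rlin). Qed.

Lemma is_bilinear_compl (k : fieldType) (A : lmodType k) (op : A -> A -> A)
    (R : A -> A) :
  is_bilinear op -> linear R -> is_bilinear (fun x y => op (R x) y).
Proof.
case=> opl opr Rlin; split=> [y | x] a u v /=; last exact: opr.
by rewrite Rlin; exact: opl.
Qed.

Lemma is_bilinear_oppcomp (k : fieldType) (A : lmodType k)
    (op : A -> A -> A) (R : A -> A) :
  is_bilinear op -> linear R -> is_bilinear (fun x y => - op (R x) (R y)).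
Proof.
case=> opl opr Rlin.
split=> [y | x] a u v /=; rewrite Rlin.
  by have /= -> := opl (R y) a (R u) (R v); rewrite opprD scalerN.
by have /= -> := opr (R x) a (R u) (R v); rewrite opprD scalerN.
Qed.

(** * Reynolds identities for binary and ternary operations *)

Definition Reynolds2 (A : zmodType) (R : A -> A) (op : A -> A -> A) : Prop :=
  forall x y, op (R x) (R y) = R (op (R x) y + op x (R y) - op (R x) (R y)).

Definition Reynolds3 (A : zmodType) (R : A -> A) (T : A -> A -> A -> A) : Prop :=
  forall x y z, T (R x) (R y) (R z) =
    R (T (R x) (R y) z + T (R x) y (R z) + T x (R y) (R z)
       - T (R x) (R y) (R z) *+ 2).

(** The correction is subtracted twice: once by the identity for [f], and once
    because [g (R y) (R z)] is [R] of an expression which itself contains the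
    correction of [g]. *)
Lemma Reynolds3_nest (k : fieldType) (A : lmodType k) (R : A -> A)
    (f g : A -> A -> A) :
  is_bilinear f -> Reynolds2 R f -> Reynolds2 R g ->
  Reynolds3 R (fun x y z => f x (g y z)).
Proof.
move=> fB fR gR x y z /=; rewrite {1}gR fR -gR; congr (R _).
rewrite (is_bilinearBr fB) (is_bilinearDr fB) mulr2n opprD.
by rewrite !addrA; congr (_ - _); exact: addrAC.
Qed.

Lemma Reynolds3_sub (k : fieldType) (A : lmodType k) (R : A -> A)
    (S T : A -> A -> A -> A) :
  linear R -> Reynolds3 R S -> Reynolds3 R T ->
  Reynolds3 R (fun x y z => S x y z - T x y z).
Proof.
move=> Rlin SR TR x y z; rewrite [in LHS]SR [in LHS]TR -(linear_sub Rlin).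
congr (R _); rewrite mulrnBl !opprD [LHS]addrACA; congr (_ + _).
by rewrite [LHS]addrACA; congr (_ + _); exact: addrACA.
Qed.

Lemma Reynolds3_swap12 (A : zmodType) (R : A -> A) (T : A -> A -> A -> A) :
  Reynolds3 R T -> Reynolds3 R (fun x y z => T y x z).
Proof.
by move=> TR x y z; rewrite [LHS]TR; congr (R (_ - _)); rewrite addrAC.
Qed.

Lemma Reynolds3_rot (A : zmodType) (R : A -> A) (T : A -> A -> A -> A) :
  Reynolds3 R T -> Reynolds3 R (fun x y z => T z x y).
Proof.
move=> TR x y z; rewrite [LHS]TR; congr (R (_ - _)).
by rewrite [LHS]addrC addrA.
Qed.

(** Commutativity of [mul] is what turns the three terms of the leibnizator
    into right-nested operations, up to a permutation of the arguments. *)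
Lemma Reynolds3_leibnizator (k : fieldType) (A : lmodType k)
    (mul br : A -> A -> A) (R : A -> A) :
  is_F_manifold_algebra mul br -> is_Reynolds_operator mul br R ->
  Reynolds3 R (leibnizator mul br).
Proof.
move=> [[mulB mulC _] [brB _ _] _] [Rlin Rmul Rbr].
have PR : Reynolds3 R
    (fun x y z => br x (mul y z) - mul z (br x y) - mul y (br x z)).
  apply: (Reynolds3_sub Rlin); last first.
    exact: (Reynolds3_swap12 (Reynolds3_nest mulB Rmul Rbr)).
  apply: (Reynolds3_sub Rlin); first exact: Reynolds3_nest.
  exact: (Reynolds3_rot (Reynolds3_nest mulB Rmul Rbr)).
by move=> x y z; rewrite /leibnizator !(mulC (br _ _)) [LHS]PR.
Qed.

(** * The induced operations *)

Lemma Reynolds_ns_odot (k : fieldType) (A : lmodType k)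
    (mul br : A -> A -> A) (R : A -> A) :
  commutative mul -> is_Reynolds_operator mul br R -> forall x y,
  R (ns_odot (fun x y => mul (R x) y) (fun x y => - mul (R x) (R y)) x y) =
  mul (R x) (R y).
Proof.
by move=> mulC [_ Rmul _] x y; rewrite /ns_odot (mulC (R y)) -Rmul.
Qed.

Lemma Reynolds_ns_bracket (k : fieldType) (A : lmodType k)
    (mul br : A -> A -> A) (R : A -> A) :
  skew_symmetric br -> is_Reynolds_operator mul br R -> forall x y,
  R (ns_bracket (fun x y => br (R x) y) (fun x y => - br (R x) (R y)) x y) =
  br (R x) (R y).
Proof.
by move=> brN [_ _ Rbr] x y; rewrite /ns_bracket -(brN x) -Rbr.
Qed.

Lemma leibnizatorC (A : zmodType) (mul br : A -> A -> A) :
  commutative mul -> forall x y z,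
  leibnizator mul br x y z = leibnizator mul br x z y.
Proof.
move=> mulC x y z; rewrite /leibnizator (mulC y z) addrAC.
by rewrite (mulC y) (mulC _ z).
Qed.

Lemma leibnizatorNl (k : fieldType) (A : lmodType k) (mul br : A -> A -> A) :
  is_bilinear mul -> is_bilinear br -> forall x y z,
  leibnizator mul br (- x) y z = - leibnizator mul br x y z.
Proof.
move=> mulB brB x y z; rewrite /leibnizator !(is_bilinearNl brB).
by rewrite (is_bilinearNl mulB) (is_bilinearNr mulB) !opprD.
Qed.

Lemma Reynolds_NS_commutative (k : fieldType) (A : lmodType k)
    (mul br : A -> A -> A) (R : A -> A) :
  is_comm_assoc_algebra mul -> is_Reynolds_operator mul br R ->
  is_NS_commutative_algebra
    (fun x y => mul (R x) y) (fun x y => - mul (R x) (R y)).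
Proof.
move=> [mulB mulC mulA] RR; have Rlin := Reynolds_linear RR.
split.
- exact: is_bilinear_compl.
- exact: is_bilinear_oppcomp.
- by move=> x y; rewrite mulC.
- by move=> x y z; rewrite (Reynolds_ns_odot mulC RR) mulA.
- move=> x y z; rewrite !(Reynolds_ns_odot mulC RR) !(is_bilinearNr mulB).
  by rewrite !mulA (mulC (R y) (R x)).
Qed.

Lemma Lie_derivation (k : fieldType) (A : lmodType k) (br : A -> A -> A) :
  is_Lie_algebra br -> forall x y z,
  br (br x y) z = br x (br y z) - br y (br x z).
Proof.
move=> [brB brN jacobi] x y z; apply/esym/eqP.
rewrite -subr_eq0 (brN (br x y)) opprK (brN x z) (is_bilinearNr brB) opprK.
by rewrite jacobi.
Qed.

Lemma Reynolds_NS_Lie (k : fieldType) (A : lmodType k)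
    (mul br : A -> A -> A) (R : A -> A) :
  is_Lie_algebra br -> is_Reynolds_operator mul br R ->
  is_NS_Lie_algebra (fun x y => br (R x) y) (fun x y => - br (R x) (R y)).
Proof.
move=> lieA RR; have [brB brN jacobi] := lieA; have [Rlin _ _] := RR.
split.
- exact: is_bilinear_compl.
- exact: is_bilinear_oppcomp.
- by move=> x y; rewrite brN.
- move=> x y z.
  (* Only the total bracket has a known image under R; the value on its last
     summand is obtained by difference. *)
  have bulE : R (- br (R x) (R y)) =
      br (R x) (R y) - (R (br (R x) y) - R (br (R y) x)).
    rewrite -[X in _ = X - _](Reynolds_ns_bracket brN RR) -!(linear_sub Rlin).
    by congr (R _); rewrite /ns_bracket [X in _ = X - _]addrC addrK.
  rewrite bulE !(is_bilinearBl brB) (Lie_derivation lieA).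
  by rewrite opprB [LHS](ACl (1 * 3 * (4 * 2))).
- move=> x y z; rewrite !(Reynolds_ns_bracket brN RR) !(is_bilinearNr brB).
  by rewrite -!opprD jacobi add0r jacobi oppr0.
Qed.

Lemma Reynolds_F1 (k : fieldType) (A : lmodType k)
    (mul br : A -> A -> A) (R : A -> A) :
  skew_symmetric br -> is_Reynolds_operator mul br R -> forall x y z,
  ns_F1 (fun x y => mul (R x) y) (fun x y => br (R x) y)
    (fun x y => - br (R x) (R y)) x y z = leibnizator mul br (R x) (R y) z.
Proof.
move=> brN RR x y z.
by rewrite /ns_F1 (Reynolds_ns_bracket brN RR) addrAC.
Qed.

Lemma Reynolds_F2 (k : fieldType) (A : lmodType k)
    (mul br : A -> A -> A) (R : A -> A) :
  is_F_manifold_algebra mul br -> is_Reynolds_operator mul br R ->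
  forall x y z,
  ns_F2 (fun x y => mul (R x) y) (fun x y => - mul (R x) (R y))
    (fun x y => br (R x) y) x y z = leibnizator mul br z (R x) (R y).
Proof.
move=> [[mulB mulC _] [_ brN _] _] RR x y z.
rewrite /ns_F2 (Reynolds_ns_odot mulC RR) /leibnizator (mulC (br _ _)).
rewrite (brN (R y) z) (brN (R x) z) (brN _ z) !(is_bilinearNr mulB) opprK.
by rewrite [LHS]addrC addrA addrAC.
Qed.

(** The factor [2] arises because each of the three terms of the leibnizator
    occurs twice in [F3]: once through a total product, once through a bare
    operation of the induced structure. *)
Lemma Reynolds_F3 (k : fieldType) (A : lmodType k)
    (mul br : A -> A -> A) (R : A -> A) :
  is_F_manifold_algebra mul br -> is_Reynolds_operator mul br R ->
  forall x y z,
  ns_F3 (fun x y => mul (R x) y) (fun x y => - mul (R x) (R y))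
    (fun x y => br (R x) y) (fun x y => - br (R x) (R y)) x y z =
  - leibnizator mul br (R x) (R y) (R z) *+ 2.
Proof.
move=> [[mulB mulC _] [brB brN _] _] RR x y z.
rewrite /ns_F3 (Reynolds_ns_odot mulC RR) !(Reynolds_ns_bracket brN RR).
rewrite !(is_bilinearNr brB) !(is_bilinearNr mulB) /leibnizator.
rewrite !opprK (mulC (R z)) mulr2n !opprD !opprK.
by rewrite [LHS](ACl (1 * 6 * 4 * (2 * 3 * 5))).
Qed.

Theorem proposition5p10 (k : fieldType) (k_char0 : [pchar k] =i pred0)
    (A : lmodType k) (mul br : A -> A -> A) (R : A -> A)
    (A_Fman : is_F_manifold_algebra mul br)
    (R_Reynolds : is_Reynolds_operator mul br R) :
  is_NS_F_manifold_algebra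
    (fun x y => mul (R x) y)
    (fun x y => - mul (R x) (R y))
    (fun x y => br (R x) y)
    (fun x y => - br (R x) (R y)).
Proof.
have [mulA brA HM] := A_Fman; have [mulB mulC _] := mulA.
have brN := Lie_skew brA.
have F1E := Reynolds_F1 brN R_Reynolds.
have F2E := Reynolds_F2 A_Fman R_Reynolds.
have F3E := Reynolds_F3 A_Fman R_Reynolds.
have odotE := Reynolds_ns_odot mulC R_Reynolds.
have FE x y z : R (leibnizator mul br (R x) (R y) z
    + leibnizator mul br (R x) (R z) y + leibnizator mul br x (R y) (R z)
    - leibnizator mul br (R x) (R y) (R z) *+ 2) =
    leibnizator mul br (R x) (R y) (R z).
  rewrite (leibnizatorC br mulC _ (R z) y).
  by rewrite -(Reynolds3_leibnizator A_Fman R_Reynolds).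
split.
- exact: (Reynolds_NS_commutative mulA R_Reynolds).
- exact: (Reynolds_NS_Lie brA R_Reynolds).
- by move=> x y z w F1; rewrite /F1 !F1E odotE HM.
- move=> x y z w F1 F2 F3; rewrite /F1 /F2 /F3 !F1E !F2E F3E mulNrn FE HM.
  by rewrite [X in _ = X - _]addrC addrK mulC.
- (* With U and V the two terms of the Hertling-Manin relation, both sides are
     -3 (U + V); on the left -2 comes from F3 and -1 from F2, on the right -2
     from F3 and -1 from the terms in the induced commutative operation. *)
  move=> x y z w F1 F2 F3; rewrite /F1 /F2 /F3 !F1E !F2E !F3E !mulNrn !FE.
  rewrite odotE (mulC (R y) (R x)) (leibnizatorNl mulB (Lie_bilinear brA)) HM.
  rewrite !mulr2n !(is_bilinearNr mulB) !(is_bilinearDr mulB) -!mulr2n.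
  by rewrite mulrnDl !opprD !addrA.
Qed.
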